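(* Let $b\ge0$ be a fixed integer. For $z\in\mathbb C\setminus\text{bands}$, $$\lim_{m\to\infty}\Gamma_+(z)^{-m}\,p_{mp+b-1}(z)=j_b(z),\qquad j_b(z):=a(z)\,q_{b-2}(z)+b(z)\,p_{b-1}(z).$$ In particular, for $z_0\in\mathbb C\setminus\text{bands}$: (1) If $j_b(z_0)\ne0$, then $p_{mp+b-1}(z)$ is nonvanishing near $z_0$ for $m$ large (there are $\varepsilon>0$ and $M$ such that $p_{mp+b-1}(z)\neq 0$ whenever $|z-z_0|<\varepsilon$ and $m\ge M$). (2) If $j_b(z_0)=0$, then $p_{mp+b-1}(z)$ has a zero near $z_0$ for $m$ large, and it has $k$ zeros (counting multiplicity) near $z_0$ if $j_b$ has a $k$-th order zero at $z_0$ (for every sufficiently small $\varepsilon>0$ there is $M$ such that for $m\ge M$ there are exactly $k$ zeros in $|z-z_0|<\varepsilon$). (3) If $b\ge1$, there are at most $2p+2b-3$ points $z_0\in\mathbb C\setminus\text{bands}$ where $j_b(z_0)=0$.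
   Context: Let $p\ge 1$ and let $\{a_n\}_{n\ge1}$, $\{b_n\}_{n\ge1}$ be real sequences with $a_n>0$, $a_{n+p}=a_n$, $b_{n+p}=b_n$. The orthonormal polynomials $p_n$ are defined by $p_{-1}\equiv0$, $p_0\equiv1$, $xp_n(x)=a_{n+1}p_{n+1}(x)+b_{n+1}p_n(x)+a_np_{n-1}(x)$ for $n\ge0$ (with $a_0:=a_p$). Let $A_k(z)=\frac1{a_{k+1}}\begin{pmatrix} z-b_{k+1}&-a_k\\ a_{k+1}&0\end{pmatrix}$, $T_n(z)=A_{n-1}(z)\cdots A_0(z)$ ($T_0=\mathbf 1$). Polynomials $q_n$ are defined by $T_n(z)=\begin{pmatrix} p_n(z)&q_{n-1}(z)\\ p_{n-1}(z)&q_{n-2}(z)\end{pmatrix}$, so $q_{-2}\equiv1$, $q_{-1}\equiv0$. Let $\Delta(z)=\mathrm{Tr}(T_p(z))$, a polynomial of degree $p$. The set $\{z\in\mathbb C:\Delta(z)\in(-2,2)\}$ is a union of $p$ disjoint open real intervals $(\alpha_j,\beta_j)$, with $\alpha_1<\beta_1\le\alpha_2<\cdots\le\alpha_p<\beta_p$; the bands are $[\alpha_j,\beta_j]$, $j=1,\dots,p$, and $\mathbb C\setminus\text{bands}$ means $\mathbb C\setminus\bigcup_j[\alpha_j,\beta_j]$. Since $\det T_p=1$, $T_p(z)$ has eigenvalues $\Gamma_\pm(z)=\frac{\Delta(z)}2\pm\sqrt{(\Delta(z)/2)^2-1}$, labelled on $\mathbb C\setminus\text{bands}$ so that $|\Gamma_+(z)|>|\Gamma_-(z)|$;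 they are analytic there. Put $P_+(z)=\dfrac{T_p(z)-\Gamma_-(z)\mathbf 1}{\Gamma_+(z)-\Gamma_-(z)}$. Let $a(z)$ be the $(2,1)$ entry of $P_+(z)$ and let $b(z)$ be the $(1,1)$ entry of $P_+(z)$. (The function $b(z)$ is not to be confused with the integer $b$ or the coefficients $b_n$.) *)

(* Defs.v *)
From HB Require Import structures.
From mathcomp Require Import all_boot all_order all_algebra.
From mathcomp Require Import all_classical all_reals all_analysis.
From mathcomp Require Import complex.

Set Implicit Arguments.
Unset Strict Implicit.
Unset Printing Implicit Defensive.

Import Order.TTheory GRing.Theory Num.Theory.
Import numFieldNormedType.Exports.

Local Open Scope classical_set_scope.
Local Open Scope complex_scope.
Local Open Scope ring_scope.

(* The complex numbers R[i] packed as a numClosedFieldType: the topology and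
   normed-module instances of numFieldNormedType are found through the
   structure, not through the bare type R[i]. *)
Definition Cx (R : realType) : numClosedFieldType := R[i].

Definition cx (R : realType) (x : R) : Cx R := x%:C.

Definition mx2 (T : Type) (x y z t : T) : 'M[T]_2 :=
  \matrix_(i, j) if i == 0 then (if j == 0 then x else y)
                 else (if j == 0 then z else t).

(* Index shift: orthop a_ b_ n is p_{n-1}, so that p_{-1} = 0 is the value at
   n = 0.  The recurrence is x p_n = a_{n+1} p_{n+1} + b_{n+1} p_n + a_n p_{n-1}
   solved for p_{n+1}. *)
Fixpoint orthop (R : realType) (a_ b_ : nat -> R) (n : nat) : {poly Cx R} :=
  match n with
  | 0 => 0
  | n'.+1 =>
    match n' with
    | 0 => 1
    | k.+1 => (cx (a_ k.+1))^-1 *: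
        (('X - (cx (b_ k.+1))%:P) * orthop a_ b_ n' - cx (a_ k) *: orthop a_ b_ k)
    end
  end.

Definition transfer_step (R : realType) (a_ b_ : nat -> R) (k : nat) :
    'M[{poly Cx R}]_2 :=
  ((cx (a_ k.+1))^-1)%:P *:
    mx2 ('X - (cx (b_ k.+1))%:P) (- (cx (a_ k))%:P)
        (cx (a_ k.+1))%:P        0.

Fixpoint transfer (R : realType) (a_ b_ : nat -> R) (n : nat) :
    'M[{poly Cx R}]_2 :=
  match n with
  | 0 => 1%:M
  | k.+1 => transfer_step a_ b_ k *m transfer a_ b_ k
  end.

(* Index shift: secondp a_ b_ n is q_{n-2}, the lower right entry of T_n. *)
Definition secondp (R : realType) (a_ b_ : nat -> R) (n : nat) : {poly Cx R} :=
  transfer a_ b_ n 1 1.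

Definition discriminant (R : realType) (p : nat) (a_ b_ : nat -> R) :
    {poly Cx R} :=
  \tr (transfer a_ b_ p).

(* The order of Cx R is partial: x < y holds iff x and y have the same
   imaginary part and Re x < Re y.  Hence -2 < w < 2 says that w is real and
   lies in (-2, 2), and similarly for the intervals below. *)
Definition band_edges (R : realType) (p : nat) (a_ b_ : nat -> R)
    (alpha beta : 'I_p -> R) : Prop :=
  [/\ forall j, alpha j < beta j,
      forall i j : 'I_p, (i < j)%N -> beta i <= alpha j &
      forall z : Cx R, -2 < (discriminant p a_ b_).[z] < 2 <->
        exists j, cx (alpha j) < z < cx (beta j)].

Definition bands (R : realType) (p : nat) (alpha beta : 'I_p -> R) :
    set (Cx R) :=
  [set z | exists j, cx (alpha j) <= z <= cx (beta j)].

(* Delta/2 + s and Delta/2 - s with s a square root of (Delta/2)^2 - 1; off the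
   bands they have different moduli. *)
Definition Gamma_plus (R : realType) (p : nat) (a_ b_ : nat -> R) (z : Cx R) :
    Cx R :=
  let d := (discriminant p a_ b_).[z] / 2 in
  let s := sqrtC (d ^+ 2 - 1) in
  if `|d - s| < `|d + s| then d + s else d - s.

Definition Gamma_minus (R : realType) (p : nat) (a_ b_ : nat -> R) (z : Cx R) :
    Cx R :=
  let d := (discriminant p a_ b_).[z] / 2 in
  let s := sqrtC (d ^+ 2 - 1) in
  if `|d - s| < `|d + s| then d - s else d + s.

Definition P_plus (R : realType) (p : nat) (a_ b_ : nat -> R) (z : Cx R) :
    'M[Cx R]_2 :=
  (Gamma_plus p a_ b_ z - Gamma_minus p a_ b_ z)^-1 *:
    (map_mx (horner_eval z) (transfer a_ b_ p) - (Gamma_minus p a_ b_ z)%:M).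

(* With the index shifts above, q_{b-2} is secondp b and p_{b-1} is orthop b. *)
Definition jfun (R : realType) (p : nat) (a_ b_ : nat -> R) (b : nat)
    (z : Cx R) : Cx R :=
  P_plus p a_ b_ z 1 0 * (secondp a_ b_ b).[z] +
  P_plus p a_ b_ z 0 0 * (orthop a_ b_ b).[z].

(* Derivability is with respect to the complex field, hence holomorphy. *)
Definition zero_of_order (R : realType) (f : Cx R -> Cx R) (z0 : Cx R)
    (k : nat) : Prop :=
  exists g : Cx R -> Cx R,
    [/\ \forall z \near z0, derivable g z 1,
        g z0 != 0 &
        \forall z \near z0, f z = (z - z0) ^+ k * g z].

(* The list s enumerates all the zeros in the disc, so the zero polynomial is
   excluded. *)
Definition zeros_in_disc (R : realType) (P : {poly Cx R}) (z0 : Cx R) (e : R)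
    (k : nat) : Prop :=
  exists s : seq (Cx R),
    [/\ uniq s,
        forall z, z \in s = (`|z - z0| < cx e) && root P z &
        (\sum_(z <- s) mup z P)%N = k].

(* Main.v *)
Require Import Defs.
From HB Require Import structures.
From mathcomp Require Import all_boot all_order all_algebra.
From mathcomp Require Import all_classical all_reals all_analysis.
From mathcomp Require Import complex.
From mathcomp Require Import ring lra zify.

Set Implicit Arguments.
Unset Strict Implicit.
Unset Printing Implicit Defensive.

Import Order.TTheory GRing.Theory Num.Theory.
Import numFieldNormedType.Exports.

Local Open Scope classical_set_scope.
Local Open Scope ring_scope.

(** Write u_m for p_{mp+b-1} and T for the transfer matrix T_p.  As det T = 1,
    Cayley-Hamilton gives T^2 = Delta T - 1, hence by periodicity
    u_{m+2} = Delta u_{m+1} - u_m, and solving this recurrence yields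
      u_m = Gamma_+^m j_b + Gamma_-^m B.
    Off the bands Delta is not in [-2, 2], which is equivalent to
    |Gamma_-| < 1 < |Gamma_+|, so that Gamma_+^{-m} u_m tends to j_b.  That
    Delta avoids the endpoints 2 and -2 off the bands comes from continuity of
    roots: a value of Delta slightly inside (-2, 2) is taken near any point
    where Delta is 2 or -2, hence such a point is a limit of points of the
    bands, which are closed (off_bands_discriminant).

    For the statements about zeros Gamma_+^m is replaced by the polynomial
    D_m = Tr T^m = Gamma_+^m + Gamma_-^m, which has no zeros off the bands;
    u_m / D_m still tends to j_b, locally uniformly
    (orthop_trace_power_unif).  Nonvanishing of u_m where j_b does not vanish
    is then immediate.  The existence and the number of zeros are Hurwitz's
    theorem, but only polynomials have to be compared, so no complex
    integration is needed: Jensen's formula suffices.  For a polynomial P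
    with leading coefficient c and roots r_i, the geometric mean of |P| on the
    circle of centre z and radius e is |c| prod_i max(|r_i - z|, e).  It is
    approached by the geometric means over the e w with w^N = 1, which are
    computed exactly by prod_w (x - e w) = x^N - e^N.  Bounds between |P| and
    |Q| on a circle thus pass to these products (jensen_compare).
    If u_m had no zero in a small disc around a zero z_0 of j_b, its mean on
    the boundary would be |u_m(z_0)|, too small compared to |D_m(z_0)|
    (zero_in_disc).  If j_b behaves like c (z - z_0)^k, then doubling the
    radius multiplies the mean of u_m by 2^n, with n its number of zeros, and
    that of c (z - z_0)^k D_m by 2^k; being close, they have n = k
    (zeros_in_disc_compare).

    Finally, with u = u_1 and v = u_0, a zero of j_b off the bands is a zero
    of u - Gamma_- v, thus of
      (u - Gamma_- v) (u - Gamma_+ v) = u^2 - Delta u v + v^2.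
    This polynomial is nonzero because Delta is not constant
    (quadratic_form_neq0), and since the leading terms of u and Delta v cancel
    its degree is small enough (size_zero_locus). *)

(** * The modulus as a real number *)

Section Modulus.
Variable R : realType.
Implicit Types z w : Cx R.

(** The order of the complex numbers is partial; real values make maxima,
    case distinctions and linear arithmetic available. *)
Definition cmod z : R := complex.Re `|z|.

Lemma cmodE z : `|z| = cx (cmod z).
Proof. by rewrite /cx /cmod (RRe_real (normr_real z)). Qed.

Lemma cx_inj : injective (@cx R).
Proof. exact: complexI. Qed.

Lemma cxM (x y : R) : cx (x * y) = cx x * cx y.
Proof. exact: (rmorphM (real_complex R)). Qed.

Lemma cxD (x y : R) : cx (x + y) = cx x + cx y.
Proof. exact: (rmorphD (real_complex R)). Qed.

Lemma cxN (x : R) : cx (- x) = - cx x.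
Proof. exact: (rmorphN (real_complex R)). Qed.

Lemma cxB (x y : R) : cx (x - y) = cx x - cx y.
Proof. exact: (rmorphB (real_complex R)). Qed.

Lemma cx_nat n : cx (n%:R : R) = n%:R.
Proof. exact: (rmorph_nat (real_complex R)). Qed.

Lemma cx_ge0 (x : R) : (0 <= cx x) = (0 <= x).
Proof. exact: ler0c. Qed.

Lemma cx_le (x y : R) : (cx x <= cx y) = (x <= y).
Proof. exact: lecR. Qed.

Lemma cx_lt (x y : R) : (cx x < cx y) = (x < y).
Proof. exact: ltcR. Qed.

Lemma cmod_lt z (e : R) : (`|z| < cx e) = (cmod z < e).
Proof. by rewrite cmodE cx_lt. Qed.

Lemma cmod_le z (e : R) : (`|z| <= cx e) = (cmod z <= e).
Proof. by rewrite cmodE cx_le. Qed.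

Lemma cmod_ge0 z : 0 <= cmod z.
Proof. by rewrite -cx_ge0 -cmodE normr_ge0. Qed.

Lemma cmodM z w : cmod (z * w) = cmod z * cmod w.
Proof. by apply: cx_inj; rewrite cxM -!cmodE normrM. Qed.

Lemma cmod1 : cmod 1 = 1.
Proof. by apply: cx_inj; rewrite -cmodE normr1. Qed.

Lemma cmodX z n : cmod (z ^+ n) = cmod z ^+ n.
Proof. by elim: n => [|n IH]; rewrite ?cmod1 // !exprS cmodM IH. Qed.

Lemma cmod_prod (I : Type) (s : seq I) (F : I -> Cx R) :
  cmod (\prod_(i <- s) F i) = \prod_(i <- s) cmod (F i).
Proof. exact: (big_morph cmod cmodM cmod1). Qed.

Lemma cmod_eq0 z : (cmod z == 0) = (z == 0).
Proof. by rewrite -(inj_eq cx_inj) -cmodE normr_eq0. Qed.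

Lemma cmod_gt0 z : (0 < cmod z) = (z != 0).
Proof. by rewrite lt0r cmod_eq0 cmod_ge0 andbT. Qed.

Lemma cmod0 : cmod 0 = 0.
Proof. by apply/eqP; rewrite cmod_eq0. Qed.

Lemma cmodN z : cmod (- z) = cmod z.
Proof. by rewrite /cmod normrN. Qed.

Lemma cmodBC z w : cmod (z - w) = cmod (w - z).
Proof. by rewrite /cmod distrC. Qed.

Lemma cmodD z w : cmod (z + w) <= cmod z + cmod w.
Proof. by rewrite -cx_le cxD -!cmodE ler_normD. Qed.

Lemma cmodB z w : cmod (z - w) <= cmod z + cmod w.
Proof. by rewrite -(cmodN w) cmodD. Qed.

Lemma cmodB_ge z w : cmod z - cmod w <= cmod (z - w).
Proof. by have := cmodD (z - w) w; rewrite subrK -lerBlDr. Qed.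

Lemma cmodD_ge z w : cmod z - cmod w <= cmod (z + w).
Proof. by rewrite -[w in z + w]opprK -(cmodN w) cmodB_ge. Qed.

Lemma cmod_cx (x : R) : 0 <= x -> cmod (cx x) = x.
Proof. by move=> x0; apply: cx_inj; rewrite -cmodE ger0_norm // cx_ge0. Qed.

End Modulus.

(** * Geometric means of polynomials over circles *)

Section Jensen.
Variable R : realType.
Implicit Types (P Q : {poly Cx R}) (z : Cx R) (e : R).

Lemma prodr_const_seq (A : pzSemiRingType) (I : Type) (s : seq I) (x : A) :
  \prod_(i <- s) x = x ^+ size s.
Proof. by rewrite big_const_seq count_predT iter_mulr_1. Qed.

Definition croots P : seq (Cx R) := sval (closed_field_poly_normal P).

Lemma croots_factor P :
  P = lead_coef P *: \prod_(z <- croots P) ('X - z%:P).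
Proof. exact: (svalP (closed_field_poly_normal P)). Qed.

Lemma mem_croots P z : P != 0 -> (z \in croots P) = root P z.
Proof.
move=> P0; rewrite {2}(croots_factor P) rootZ ?lead_coef_eq0 //.
by rewrite root_prod_XsubC.
Qed.

Lemma size_croots P : P != 0 -> size P = (size (croots P)).+1.
Proof.
move=> P0; rewrite {1}(croots_factor P) size_scale ?lead_coef_eq0 //.
by rewrite size_prod_XsubC.
Qed.

Lemma mup_croots P z : P != 0 -> mup z P = count_mem z (croots P).
Proof.
move=> P0; rewrite {1}(croots_factor P) -mul_polyC mupMr.
  by rewrite mu_prod_XsubC.
by rewrite rootC lead_coef_eq0.
Qed.

Lemma cmod_horner P z :
  cmod P.[z] = cmod (lead_coef P) * \prod_(r <- croots P) cmod (r - z).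
Proof.
rewrite {1}(croots_factor P) hornerZ horner_prod cmodM cmod_prod.
by congr (_ * _); apply: eq_bigr => r _; rewrite !hornerE cmodBC.
Qed.

(** If all roots were at distance at least [e] from [z], then the factorization
    would make [P.[z]] at least as large as the given bound. *)
Lemma root_near P z e : P != 0 -> 0 <= e ->
  cmod P.[z] < cmod (lead_coef P) * e ^+ (size P).-1 ->
  exists2 r, root P r & cmod (r - z) < e.
Proof.
move=> P0 e0 lt; have [/hasP[r rP re]|] := boolP (has (fun r => cmod (r - z) < e) (croots P)).
  by exists r; rewrite // -mem_croots.
rewrite -all_predC => /allP nr; move: lt; rewrite ltNge => /negP[].
rewrite cmod_horner ler_wpM2l ?cmod_ge0 // size_croots //=.
rewrite -prodr_const_seq big_seq [leRHS]big_seq ler_prod // => r /nr /=.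
by rewrite -leNgt e0 => ->.
Qed.

(** By Jensen's formula this is the geometric mean of the modulus of [P] over
    the circle with centre [z] and radius [e]. *)
Definition jensen P z e : R :=
  cmod (lead_coef P) * \prod_(r <- croots P) Num.max (cmod (r - z)) e.

(** The products of [e] with the [N]-th roots of unity, taken as the roots of
    one polynomial so that no root of unity has to be chosen. *)
Definition circle_nodes e N : seq (Cx R) := croots ('X^N - (cx e ^+ N)%:P).

Lemma circle_nodesE e N : (0 < N)%N ->
  'X^N - (cx e ^+ N)%:P = \prod_(w <- circle_nodes e N) ('X - w%:P).
Proof.
move=> N0; rewrite [LHS]croots_factor.
rewrite lead_coefDl ?lead_coefXn ?scale1r // size_polyXn.
by rewrite size_polyN ltnS (leq_trans (size_polyC_leq1 _)).
Qed.

Lemma size_circle_nodes e N : (0 < N)%N -> size (circle_nodes e N) = N.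
Proof.
move=> N0; apply/eqP; rewrite -eqSS -(size_prod_XsubC _ id) -circle_nodesE //.
by rewrite size_polyDl ?size_polyXn // size_polyN ltnS (leq_trans (size_polyC_leq1 _)).
Qed.

Lemma cmod_circle_nodes e N w : (0 < N)%N -> 0 <= e ->
  w \in circle_nodes e N -> cmod w = e.
Proof.
move=> N0 e0 wN; have : root ('X^N - (cx e ^+ N)%:P) w.
  by rewrite circle_nodesE // root_prod_XsubC.
rewrite /root !hornerE subr_eq0 => /eqP /(congr1 (@cmod R)).
rewrite !cmodX cmod_cx // => /eqP.
by rewrite eqrXn2 ?cmod_ge0 // => /eqP.
Qed.

(** Exchanging the products over nodes and roots, each root [r] contributes
    the value at [r - z] of the polynomial whose roots are the nodes. *)
Lemma prod_circle_nodes P z e N : (0 < N)%N ->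
  \prod_(w <- circle_nodes e N) cmod P.[z + w] =
  cmod (lead_coef P) ^+ N *
    \prod_(r <- croots P) cmod ((r - z) ^+ N - cx e ^+ N).
Proof.
move=> N0; under eq_bigr do rewrite cmod_horner.
rewrite big_split /= prodr_const_seq size_circle_nodes // exchange_big /=.
congr (_ * _); apply: eq_bigr => r _.
have -> : (r - z) ^+ N - cx e ^+ N = ('X^N - (cx e ^+ N)%:P).[r - z].
  by rewrite !hornerE.
rewrite circle_nodesE // horner_prod cmod_prod.
by apply: eq_bigr => w _; rewrite !hornerE opprD addrA.
Qed.

Lemma cmod_subX_le (w : Cx R) e N : 0 <= e ->
  cmod (w ^+ N - cx e ^+ N) <= 2 * Num.max (cmod w) e ^+ N.
Proof.
move=> e0; apply: (le_trans (cmodB _ _)); rewrite !cmodX cmod_cx //.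
have m1 : cmod w ^+ N <= Num.max (cmod w) e ^+ N.
  by rewrite lerXn2r ?nnegrE ?cmod_ge0 ?le_max ?cmod_ge0 ?lexx.
have m2 : e ^+ N <= Num.max (cmod w) e ^+ N.
  by rewrite lerXn2r ?nnegrE ?le_max ?cmod_ge0 ?lexx ?orbT.
by lra.
Qed.

(** As [(x / y) ^+ N <= x / y], the constant [y / (y - x)] serves for all [N]
    at once. *)
Lemma expr_gap (x y : R) : 0 <= x < y ->
  exists2 C, 0 < C & forall N, (0 < N)%N -> y ^+ N <= C * (y ^+ N - x ^+ N).
Proof.
move=> /andP[x0 xy]; have y0 : 0 < y by apply: le_lt_trans xy.
exists (y / (y - x)) => [|N N0]; first by rewrite divr_gt0 ?subr_gt0.
rewrite mulrAC ler_pdivlMr ?subr_gt0 // mulrBr mulrBr [y ^+ N * y]mulrC.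
rewrite lerD2l lerN2; case: N N0 => // N _.
rewrite !exprS -mulrA ler_wpM2l ?(ltW y0) // [leRHS]mulrC ler_wpM2l //.
by rewrite lerXn2r // ?nnegrE ltW.
Qed.

(** Together with the previous upper bound: off the circle, the factor of a
    root is the [N]-th power of its contribution to Jensen's formula, up to a
    constant independent of [N]. *)
Lemma cmod_subX_ge (w : Cx R) e : 0 < e -> cmod w != e ->
  exists2 C, 0 < C & forall N, (0 < N)%N ->
    Num.max (cmod w) e ^+ N <= C * cmod (w ^+ N - cx e ^+ N).
Proof.
move=> e0; rewrite neq_lt => /orP[] lt.
  have [|C C0 H] := @expr_gap (cmod w) e; first by rewrite cmod_ge0.
  exists C => // N N0; rewrite max_r ?(ltW lt) //; apply: (le_trans (H N N0)).
  by rewrite ler_pM2l // cmodBC (le_trans _ (cmodB_ge _ _)) // !cmodX cmod_cx // ltW.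
have [|C C0 H] := @expr_gap e (cmod w); first by rewrite ltW.
exists C => // N N0; rewrite max_l ?(ltW lt) //; apply: (le_trans (H N N0)).
by rewrite ler_pM2l // (le_trans _ (cmodB_ge _ _)) // !cmodX cmod_cx // ltW.
Qed.

(** Lets the constants independent of [N] disappear as [N] grows, without
    taking [N]-th roots: by Bernoulli's inequality the powers of a number above
    1 are unbounded. *)
Lemma bounded_expr_le1 (x C : R) :
  (forall N, (0 < N)%N -> x ^+ N <= C) -> x <= 1.
Proof.
move=> H; rewrite leNgt; apply/negP => x1.
have d0 : 0 < x - 1 by rewrite subr_gt0.
have bern N : 1 + N%:R * (x - 1) <= x ^+ N.
  elim: N => [|N IH]; first by rewrite mul0r addr0.
  rewrite exprS; have N0 : 0 <= N%:R :> R by [].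
  rewrite -natr1; have x0 : 0 <= x by lra.
  apply: le_trans (ler_wpM2l x0 IH).
  have := mulr_ge0 N0 (sqr_ge0 (x - 1)); rewrite expr2; lra.
have [N CN] : exists N : nat, C / (x - 1) < N%:R.
  by exists (Num.truncn (C / (x - 1))).+1; exact: truncnS_gt.
have {}CN : C < N%:R * (x - 1) by rewrite -ltr_pdivrMr.
have N1 := H N.+1 isT; have := bern N.+1; rewrite -natr1; lra.
Qed.

Lemma jensen_gt0 P z e : P != 0 -> 0 < e -> 0 < jensen P z e.
Proof.
move=> P0 e0; rewrite mulr_gt0 ?cmod_gt0 ?lead_coef_eq0 //.
by rewrite prodr_gt0 // => r _; rewrite lt_max e0 orbT.
Qed.

Lemma jensen_ge P z e : 0 <= e -> exists2 C, 0 < C & forall N, (0 < N)%N ->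
  \prod_(w <- circle_nodes e N) cmod P.[z + w] <= C * jensen P z e ^+ N.
Proof.
move=> e0; exists (2 ^+ size (croots P)) => [|N N0]; first by rewrite exprn_gt0.
rewrite prod_circle_nodes // exprMn mulrCA ler_wpM2l ?exprn_ge0 ?cmod_ge0 //.
rewrite -prodrXl -(prodr_const_seq _ 2) -big_split /= ler_prod // => r _.
by rewrite cmod_ge0 cmod_subX_le.
Qed.

Lemma jensen_le P z e : 0 < e ->
  (forall w, cmod w = e -> P.[z + w] != 0) ->
  exists2 C, 0 < C & forall N, (0 < N)%N ->
    jensen P z e ^+ N <= C * \prod_(w <- circle_nodes e N) cmod P.[z + w].
Proof.
move=> e0 nz; have P0 : P != 0.
  by apply/eqP => P0; have := nz (cx e); rewrite P0 horner0 cmod_cx ?ltW // eqxx => /(_ erefl).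
suff [C C0 H] : exists2 C, 0 < C & forall N, (0 < N)%N ->
  \prod_(r <- croots P) Num.max (cmod (r - z)) e ^+ N <=
    C * \prod_(r <- croots P) cmod ((r - z) ^+ N - cx e ^+ N).
  exists C => // N N0; rewrite prod_circle_nodes // exprMn mulrCA.
  by rewrite ler_wpM2l ?exprn_ge0 ?cmod_ge0 // -prodrXl H.
have : {in croots P, forall r, cmod (r - z) != e}.
  move=> r; rewrite mem_croots // => rP; apply/eqP => /nz.
  by rewrite addrC subrK => /negP[].
elim: (croots P) => [_|r s IH rs]; first by exists 1 => // N _; rewrite !big_nil mulr1.
have [C C0 HC] := IH (fun x xs => rs x (@mem_behead _ (r :: s) x xs)).
have [D D0 HD] := cmod_subX_ge e0 (rs r (mem_head _ _)).
exists (D * C); first exact: mulr_gt0.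
move=> N N0; rewrite !big_cons mulrACA ler_pM ?HC ?HD //.
  by rewrite exprn_ge0 // le_max cmod_ge0.
by rewrite prodr_ge0 // => i _; rewrite exprn_ge0 // le_max cmod_ge0.
Qed.

(** Multiply the inequality over the [N] nodes.  Both sides are [N]-th powers
    of the two means up to constants, so the [N]-th powers of the quotient of
    the means by [K] are bounded. *)
Lemma jensen_compare P Q z e (K : R) : 0 < e -> 0 < K ->
  (forall w, cmod w = e -> P.[z + w] != 0) ->
  (forall w, cmod w = e -> cmod P.[z + w] <= K * cmod Q.[z + w]) ->
  jensen P z e <= K * jensen Q z e.
Proof.
move=> e0 K0 nz le; have Q0 : Q != 0.
  apply/eqP => Q0; have ce : cmod (cx e) = e by rewrite cmod_cx ?ltW.
  have := le _ ce; rewrite Q0 horner0 cmod0 mulr0 leNgt cmod_gt0.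
  by rewrite nz.
have [C C0 HC] := jensen_le e0 nz.
have [D D0 HD] := jensen_ge Q z (ltW e0).
have J0 := jensen_gt0 z Q0 e0.
rewrite -ler_pdivrMr // -[leRHS]mul1r -ler_pdivrMr //.
apply: (@bounded_expr_le1 _ (C * D)) => N N0.
rewrite -mulrA -invfM exprMn exprVn.
rewrite ler_pdivrMr ?exprn_gt0 ?(mulr_gt0 J0 K0) ?(mulr_gt0 K0 J0) //.
apply: (le_trans (HC N N0)); rewrite -mulrA ler_pM2l //.
apply: le_trans (_ : K ^+ N * \prod_(w <- circle_nodes e N) cmod Q.[z + w] <= _).
  rewrite -{2}(size_circle_nodes e N0) -prodr_const_seq -big_split /=.
  rewrite big_seq [leRHS]big_seq ler_prod // => w ws.
  by rewrite cmod_ge0 le // (cmod_circle_nodes N0 _ ws) // ltW.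
by rewrite [_ * K]mulrC exprMn mulrCA ler_pM2l ?exprn_gt0 // HD.
Qed.

Lemma jensen_nonvanishing P z e :
  {in croots P, forall r, e <= cmod (r - z)} -> jensen P z e = cmod P.[z].
Proof.
move=> nr; rewrite cmod_horner; congr (_ * _).
by rewrite big_seq [RHS]big_seq; apply: eq_bigr => r /nr h; rewrite max_l.
Qed.

(** A root inside has its factor [max] equal to the radius, and a root outside
    both circles has it equal to its distance: the growth of the mean counts
    the zeros. *)
Lemma jensen_scale P z e (K : R) : 0 < e -> 1 < K ->
  {in croots P, forall r, cmod (r - z) < e \/ K * e <= cmod (r - z)} ->
  jensen P z (K * e) =
    K ^+ count (fun r => cmod (r - z) < K * e) (croots P) * jensen P z e.
Proof.
move=> e0 K1; rewrite /jensen mulrCA => H; congr (_ * _).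
have eK : e < K * e by rewrite -[ltLHS]mul1r ltr_pM2r.
elim: (croots P) H => [_|r s IH H]; first by rewrite !big_nil mulr1.
rewrite !big_cons /= {}IH => [|x xs]; last by apply: H; rewrite inE xs orbT.
have [lt|ge] := H r (mem_head _ _).
  have ltK := lt_trans lt eK.
  by rewrite ltK !max_r ?(ltW lt) ?(ltW ltK) // add1n exprS; ring.
by rewrite ltNge ge /= add0n !max_l ?(le_trans (ltW eK)) //; ring.
Qed.

End Jensen.

(** * Zeros of polynomials in discs *)

Section ZeroCounting.
Variable R : realType.
Implicit Types (P D : {poly Cx R}) (z : Cx R) (e : R).

(** The multiplicity of a root is its number of occurrences in the list of
    roots, so summing over distinct roots counts the list. *)
Lemma zeros_in_disc_croots P z0 e : P != 0 ->
  zeros_in_disc P z0 e (count (fun r => cmod (r - z0) < e) (croots P)).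
Proof.
move=> P0; pose s := [seq r <- croots P | cmod (r - z0) < e].
exists (undup s); split=> [|z|]; first exact: undup_uniq.
  by rewrite mem_undup mem_filter mem_croots // cmod_lt.
have E : {in s, forall z, mup z P = iterop (count_mem z s) addn 1%N 0%N}.
  move=> z; rewrite mem_filter => /andP[ze _].
  rewrite Monoid.iteropE iter_addn_0 mul1n mup_croots // count_filter.
  by apply: eq_count => x /=; case: eqP => //= ->; rewrite ze.
rewrite big_seq (eq_bigr (fun z => iterop (count_mem z s) addn 1%N 0%N)); last first.
  by move=> z; rewrite mem_undup; exact: E.
by rewrite -big_seq (big_undup_iterop_count _ s xpredT) sum1_size size_filter.
Qed.

(** Otherwise the means of both [D] and [P] over the circle would be their
    moduli at the centre, and comparing means would contradict the last
    hypothesis. *)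
Lemma zero_in_disc P D z0 e (K : R) : 0 < e -> 0 < K ->
  (forall z, cmod (z - z0) <= e -> D.[z] != 0) ->
  (forall z, cmod (z - z0) = e -> cmod D.[z] <= K * cmod P.[z]) ->
  K * cmod P.[z0] < cmod D.[z0] ->
  exists2 z, root P z & cmod (z - z0) <= e.
Proof.
move=> e0 K0 nzD le lt.
have shift (w : Cx R) : z0 + w - z0 = w by rewrite addrC addKr.
have D0 : D != 0.
  apply: contraTneq lt => ->; rewrite horner0 cmod0 -leNgt.
  by rewrite mulr_ge0 ?cmod_ge0 ?ltW.
have P0 : P != 0.
  apply/eqP => P0; have := le (z0 + cx e).
  rewrite shift cmod_cx ?(ltW e0) // P0 horner0 cmod0 mulr0 leNgt cmod_gt0.
  by rewrite nzD ?shift ?cmod_cx ?(ltW e0) // => /(_ erefl).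
apply: contrapT => none; move: lt; rewrite ltNge => /negP; apply.
have := @jensen_compare _ D P z0 e K e0 K0.
rewrite !jensen_nonvanishing; first apply.
- by move=> w we; rewrite nzD // shift we.
- by move=> w we; rewrite le // shift.
- move=> r; rewrite mem_croots // => rP; rewrite leNgt; apply/negP => lt.
  by apply: none; exists r; rewrite // ltW.
- move=> r; rewrite mem_croots // => rD; rewrite leNgt; apply/negP => lt.
  by move: (nzD r (ltW lt)) => /negP[].
Qed.

Lemma cmod_quarter (x y : Cx R) : 4 * cmod (x - y) <= cmod y ->
  4 * cmod x <= 5 * cmod y /\ 3 * cmod y <= 4 * cmod x.
Proof.
have := cmodB_ge x y; have := cmodB_ge y x; rewrite (cmodBC y x).
move: (cmod (x - y)) (cmod x) (cmod y) => r s t; lra.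
Qed.

(** The constants matter only through [5 / 3 < 2]: for powers of two the
    conclusion forces equality. *)
Lemma doubling_gap (x y t u : R) : 0 < x -> 0 < y -> 0 < t ->
  3 * t <= 4 * u <= 5 * t -> 3 * (x * t) <= 4 * (y * u) <= 5 * (x * t) ->
  (x < 2 * y) && (y < 2 * x).
Proof.
move=> x0 y0 t0 /andP[A1 A2] /andP[A3 A4]; apply/andP; split.
  rewrite -(ltr_pM2r t0); have := ler_wpM2l (ltW y0) A2.
  by have := mulr_gt0 x0 t0; have := mulr_gt0 y0 t0; lra.
rewrite -(ltr_pM2r t0); have := ler_wpM2l (ltW y0) A1.
by have := mulr_gt0 x0 t0; have := mulr_gt0 y0 t0; lra.
Qed.

(** A form of the theorem of Rouche in which only moduli are compared.  The
    mean of [P] is within a quarter of that of [(z - z0) ^+ k * c * D] on the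
    circles of radius [e / 2] and [e]; between them the first grows by
    [2 ^+ n], where [n] counts the zeros of [P], and the second by [2 ^+ k]. *)
Lemma zeros_in_disc_compare P D z0 e (c : Cx R) k : 0 < e -> c != 0 ->
  (forall z, cmod (z - z0) <= e -> D.[z] != 0) ->
  (forall z, e / 2 <= cmod (z - z0) <= e ->
     4 * cmod (P.[z] - (z - z0) ^+ k * c * D.[z])
       <= cmod ((z - z0) ^+ k * c * D.[z])) ->
  zeros_in_disc P z0 e k.
Proof.
move=> e0 c0 nzD close.
have shift (w : Cx R) : z0 + w - z0 = w by rewrite addrC addKr.
have D0 : D != 0.
  apply/eqP => D0; have := nzD z0; rewrite subrr cmod0 D0 horner0 eqxx.
  by move=> /(_ (ltW e0)).
have Dz0 : 0 < cmod D.[z0] by rewrite cmod_gt0 nzD // subrr cmod0 ltW.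
have cg : 0 < cmod c by rewrite cmod_gt0.
have h0 : 0 < e / 2 by rewrite divr_gt0.
have he : e / 2 <= e by lra.
have ub z : e / 2 <= cmod (z - z0) <= e ->
  4 * cmod P.[z] <= 5 * (cmod (z - z0) ^+ k * cmod c * cmod D.[z]).
  by move=> /close /cmod_quarter[]; rewrite !cmodM cmodX.
have lb z : e / 2 <= cmod (z - z0) <= e ->
  3 * (cmod (z - z0) ^+ k * cmod c * cmod D.[z]) <= 4 * cmod P.[z].
  by move=> /close /cmod_quarter[]; rewrite !cmodM cmodX.
have nzP z : e / 2 <= cmod (z - z0) <= e -> P.[z] != 0.
  move=> hz; have [h1 h2] := andP hz; rewrite -cmod_gt0.
  have : 0 < cmod (z - z0) ^+ k * cmod c * cmod D.[z].
    rewrite !mulr_gt0 ?exprn_gt0 ?(lt_le_trans h0 h1) //.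
    by rewrite cmod_gt0 nzD.
  have := lb z hz; lra.
have P0 : P != 0.
  apply/eqP => P0; have := nzP (z0 + cx e); rewrite shift cmod_cx ?(ltW e0) //.
  by rewrite he lexx P0 horner0 eqxx => /(_ isT).
have JD r : 0 < r -> r <= e -> jensen D z0 r = cmod D.[z0].
  move=> r0 re; apply: jensen_nonvanishing => x; rewrite mem_croots // => xD.
  rewrite leNgt; apply/negP => lt.
  by have /negP[] := nzD x (ltW (lt_le_trans lt re)).
have Jub r : e / 2 <= r <= e ->
  4 * jensen P z0 r <= 5 * (r ^+ k * cmod c * cmod D.[z0]).
  move=> /andP[r1 r2]; have r0 : 0 < r by exact: lt_le_trans r1.
  rewrite -(JD r) //; set q := r ^+ k * cmod c.
  have q0 : 0 < q by rewrite mulr_gt0 ?exprn_gt0.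
  have k0 : 0 < 5 / 4 * q by lra.
  have H := @jensen_compare _ P D z0 r _ r0 k0.
  have : jensen P z0 r <= 5 / 4 * q * jensen D z0 r.
    apply: H => w wr; first by rewrite nzP // shift wr r1.
    have := ub (z0 + w); rewrite shift wr r1 r2 => /(_ isT); rewrite -/q.
    by move: (cmod _) (cmod _) => x y; lra.
  by move: (jensen _ _ _) (jensen _ _ _) => x y; lra.
have Jlb r : e / 2 <= r <= e ->
  3 * (r ^+ k * cmod c * cmod D.[z0]) <= 4 * jensen P z0 r.
  move=> /andP[r1 r2]; have r0 : 0 < r by exact: lt_le_trans r1.
  rewrite -(JD r) //; set q := r ^+ k * cmod c.
  have q0 : 0 < q by rewrite mulr_gt0 ?exprn_gt0.
  have k0 : 0 < 4 / 3 / q by rewrite divr_gt0.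
  have H := @jensen_compare _ D P z0 r _ r0 k0.
  have : jensen D z0 r <= 4 / 3 / q * jensen P z0 r.
    apply: H => w wr; first by rewrite nzD // shift wr.
    have := lb (z0 + w); rewrite shift wr r1 r2 => /(_ isT); rewrite -/q => h.
    by rewrite mulrAC ler_pdivlMr //; lra.
  by rewrite mulrAC ler_pdivlMr //; lra.
have sep : {in croots P, forall r, cmod (r - z0) < e / 2 \/ 2 * (e / 2) <= cmod (r - z0)}.
  move=> r; rewrite mem_croots // => rP; have [?|h1] := ltP; first by left.
  right; rewrite mulrC divfK // leNgt; apply/negP => h2.
  have /nzP/negP[] : e / 2 <= cmod (r - z0) <= e by rewrite h1 ltW.
  exact: rP.
have := zeros_in_disc_croots z0 e P0.
have := jensen_scale h0 (ltr1n R 2) sep.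
have -> : 2 * (e / 2) = e by rewrite mulrC divfK.
set n := count _ _; move=> Jn; suff -> : n = k by [].
have h1 : e / 2 <= e / 2 <= e by rewrite lexx.
have h2 : e / 2 <= e <= e by rewrite lexx he.
have := Jub _ h2; have := Jlb _ h2; have := Jub _ h1; have := Jlb _ h1.
rewrite Jn; set q := cmod c * cmod D.[z0].
have q0 : 0 < q by rewrite mulr_gt0.
have -> : e ^+ k = 2 ^+ k * (e / 2) ^+ k by rewrite -exprMn mulrC divfK.
rewrite -!mulrA -/q; set t := (e / 2) ^+ k * q.
have t0 : 0 < t by rewrite mulr_gt0 ?exprn_gt0.
move=> A1 A2 A3 A4; have X (i : nat) : 0 < 2 ^+ i :> R by rewrite exprn_gt0.
have /andP[] : (2 ^+ k < 2 * 2 ^+ n :> R) && (2 ^+ n < 2 * 2 ^+ k :> R).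
  by apply: (@doubling_gap _ _ t (jensen P z0 (e / 2))); rewrite ?A1 ?A2 ?A3 ?A4.
rewrite -!exprS !ltr_eXn2l ?ltr1n // !ltnS => kn nk.
by apply/eqP; rewrite eqn_leq nk kn.
Qed.

End ZeroCounting.

(** * Linear recurrences and quadratic forms *)

Section Recurrence.

Lemma linear_recurrence_closed (F : comPzRingType) (g h : F) (w : nat -> F) :
  (forall m, w m.+2 = (g + h) * w m.+1 - g * h * w m) ->
  forall m, (g - h) * w m =
    g ^+ m * (w 1%N - h * w 0%N) - h ^+ m * (w 1%N - g * w 0%N).
Proof.
move=> rec; suff H m : (g - h) * w m =
    g ^+ m * (w 1%N - h * w 0%N) - h ^+ m * (w 1%N - g * w 0%N) /\
  (g - h) * w m.+1 =
    g ^+ m.+1 * (w 1%N - h * w 0%N) - h ^+ m.+1 * (w 1%N - g * w 0%N).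
  by move=> m; case: (H m).
elim: m => [|m [IH1 IH2]]; first by rewrite !expr0 !expr1; split; ring.
split; rewrite // rec mulrBr mulrCA IH2 [X in _ - X]mulrCA IH1 !exprS; ring.
Qed.

Lemma det_mx22 (A : comPzRingType) (M : 'M[A]_2) :
  \det M = M 0 0 * M 1 1 - M 0 1 * M 1 0.
Proof.
rewrite (expand_det_row _ 0) !big_ord_recl big_ord0 /cofactor !det_mx11 !mxE /=.
have -> : lift 0 0 = 1 :> 'I_2 by apply: val_inj.
have -> : lift 1 0 = 0 :> 'I_2 by apply: val_inj.
by rewrite expr0 expr1; ring.
Qed.

(** Cayley-Hamilton in dimension 2. *)
Lemma mx22_square (A : comPzRingType) (M : 'M[A]_2) :
  M *m M = \tr M *: M - (\det M)%:M.
Proof.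
apply/matrixP => i j; rewrite det_mx22 /mxtrace !mxE !big_ord_recl !big_ord0 /=.
have E (k : 'I_2) : k = 0 \/ k = 1.
  by case: k => [[|[|]]] // ?; [left|right]; apply: val_inj.
have -> : lift 0 0 = 1 :> 'I_2 by apply: val_inj.
by case: (E i) => ->; case: (E j) => -> /=; rewrite ?mulr1n ?mulr0n; ring.
Qed.

(** After division by the gcd, [U] and [V] are coprime and each divides the
    square of the other if the form vanishes; then both are constant, and so
    is [D]. *)
Lemma quadratic_form_neq0 (F : fieldType) (U V D : {poly F}) :
  (1 < size D)%N -> U != 0 -> U ^+ 2 - D * U * V + V ^+ 2 != 0.
Proof.
move=> sD U0; set G := gcdp U V.
have G0 : G != 0 by rewrite gcdp_eq0 negb_and U0.
have /dvdpP[u Uu] : G %| U by exact: dvdp_gcdl.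
have /dvdpP[v Vv] : G %| V by exact: dvdp_gcdr.
have cuv : coprimep u v.
  have : coprimep (U %/ G) (V %/ G) by rewrite coprimep_div_gcd // U0.
  by rewrite {1}Uu {1}Vv !mulpK.
apply/eqP => N0; have : (u ^+ 2 - D * u * v + v ^+ 2) * G ^+ 2 = 0.
  by rewrite -[RHS]N0 Uu Vv; ring.
move=> /eqP; rewrite mulf_eq0 expf_eq0 /= (negPf G0) orbF => /eqP n0.
have su : size u == 1%N.
  rewrite -dvdp1 -(@Gauss_dvdpr _ 1 (v ^+ 2) u) ?mulr1; last by rewrite coprimep_expr.
  have -> : v ^+ 2 = u * (D * v - u) by rewrite -[LHS]subr0 -n0; ring.
  by rewrite dvdp_mulIl.
have sv : size v == 1%N.
  rewrite -dvdp1 -(@Gauss_dvdpr _ 1 (u ^+ 2) v) ?mulr1; last first.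
    by rewrite coprimep_expr // coprimep_sym.
  have -> : u ^+ 2 = v * (D * u - v) by rewrite -[LHS]subr0 -n0; ring.
  by rewrite dvdp_mulIl.
move: n0; have /size_poly1P[x x0 ->] := su; have /size_poly1P[y y0 ->] := sv.
move=> n0; have : D * (x * y)%:P = (x ^+ 2 + y ^+ 2)%:P.
  by rewrite -[RHS]subr0 -n0 !(polyCM, polyCD, rmorphXn) /=; ring.
move=> /(congr1 (fun P : {poly F} => size P)).
rewrite mulrC mul_polyC size_scale ?mulf_neq0 // => sD1.
by move: sD; rewrite sD1 ltnNge size_polyC_leq1.
Qed.

End Recurrence.

(** * Transfer matrices and orthonormal polynomials *)

Section Transfer.
Variables (R : realType) (p : nat) (a_ b_ : nat -> R).
Hypothesis a_gt0 : forall n, (0 < n)%N -> 0 < a_ n.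

Local Notation T := (transfer a_ b_).
Local Notation U := (orthop a_ b_).
Local Notation Delta := (discriminant p a_ b_).

Let cx_a_neq0 n : (0 < n)%N -> cx (a_ n) != 0.
Proof.
move=> /a_gt0 an; rewrite -cmod_gt0 cmod_cx ?ltW //.
Qed.

Let ord2_1 : lift ord0 ord0 = 1 :> 'I_2. Proof. exact: val_inj. Qed.

Lemma transferS0 n j : T n.+1 0 j =
  (cx (a_ n.+1))^-1 *: (('X - (cx (b_ n.+1))%:P) * T n 0 j - cx (a_ n) *: T n 1 j).
Proof.
rewrite /= -scalemxAl mxE -mul_polyC mxE !big_ord_recl big_ord0 ord2_1 !mxE /=.
by rewrite -[cx (a_ n) *: _]mul_polyC; congr (_ * _); ring.
Qed.

Lemma transferS1 n j : T n.+1 1 j = T n 0 j.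
Proof.
rewrite /= -scalemxAl mxE mxE !big_ord_recl big_ord0 ord2_1 !mxE /=.
rewrite mul0r !addr0 mulrA -polyCM mulVf ?mul1r // cx_a_neq0 //.
Qed.

Lemma orthopSS n : U n.+2 =
  (cx (a_ n.+1))^-1 *: (('X - (cx (b_ n.+1))%:P) * U n.+1 - cx (a_ n) *: U n).
Proof. by []. Qed.

Lemma transfer_orthop n : T n 1 0 = U n /\ T n 0 0 = U n.+1.
Proof.
elim: n => [|n [IH1 IH0]]; first by split; rewrite /= mxE.
by split; [rewrite transferS1|rewrite transferS0 IH1 orthopSS -IH0].
Qed.

Lemma transfer10 n : T n 1 0 = U n. Proof. by case: (transfer_orthop n). Qed.
Lemma transfer00 n : T n 0 0 = U n.+1. Proof. by case: (transfer_orthop n). Qed.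

Lemma size_orthop n : size (U n) = n.
Proof.
suff [] : size (U n) = n /\ size (U n.+1) = n.+1 by [].
elim: n => [|n [IH1 IH2]].
  by split; [exact: size_poly0|exact: size_poly1].
split=> //; rewrite orthopSS size_scale ?invr_eq0 ?cx_a_neq0 //.
have s : size (('X - (cx (b_ n.+1))%:P) * U n.+1) = n.+2.
  by rewrite size_monicM ?monicXsubC -?size_poly_eq0 ?IH2 // size_XsubC.
rewrite size_polyDl ?s // size_polyN.
by rewrite (leq_ltn_trans (size_scale_leq _ _)) // IH1.
Qed.

Lemma size_transfer01 n : (size (T n 0 1)%R <= n)%N.
Proof.
suff [] : (size (T n 0 1)%R <= n)%N /\ (size (T n.+1 0 1)%R <= n.+1)%N by [].
elim: n => [|n [IH1 IH2]].
  split; first by rewrite !mxE size_poly0.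
  rewrite transferS0 !mxE /= mulr0 sub0r (leq_trans (size_scale_leq _ _)) //.
  by rewrite size_polyN (leq_trans (size_scale_leq _ _)) // size_poly1.
split=> //; rewrite transferS0 (leq_trans (size_scale_leq _ _)) //.
rewrite (leq_trans (size_polyD _ _)) // geq_max; apply/andP; split.
  by rewrite (leq_trans (size_polyMleq _ _)) // size_XsubC.
rewrite size_polyN transferS1 (leq_trans (size_scale_leq _ _)) //.
by rewrite (leq_trans IH1) // leqW.
Qed.

Lemma size_secondp n : (0 < n)%N -> (size (secondp a_ b_ n) <= n.-1)%N.
Proof. by case: n => // n _; rewrite /secondp transferS1 size_transfer01. Qed.

Lemma discriminantE : Delta = U p.+1 + secondp a_ b_ p.
Proof.
by rewrite /discriminant /mxtrace !big_ord_recl big_ord0 ord2_1 addr0 transfer00.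
Qed.

Lemma size_discriminant : (0 < p)%N -> size Delta = p.+1.
Proof.
move=> p0; rewrite discriminantE size_polyDl ?size_orthop //.
by rewrite ltnS (leq_trans (size_secondp p0)) // leq_pred.
Qed.

Hypothesis p_gt0 : (0 < p)%N.
Hypothesis a_per : forall n, (0 < n)%N -> a_ (n + p)%N = a_ n.
Hypothesis b_per : forall n, (0 < n)%N -> b_ (n + p)%N = b_ n.
Hypothesis a_0 : a_ 0%N = a_ p.

Lemma transferS n : T n.+1 = transfer_step a_ b_ n *m T n.
Proof. by []. Qed.

Lemma transfer_step_addp n : transfer_step a_ b_ (n + p) = transfer_step a_ b_ n.
Proof.
have an : a_ (n + p).+1 = a_ n.+1 by rewrite -addSn a_per.
have bn : b_ (n + p).+1 = b_ n.+1 by rewrite -addSn b_per.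
have a'n : a_ (n + p)%N = a_ n.
  by case: n {an bn} => [|n]; rewrite ?add0n ?a_0 // a_per.
by rewrite /transfer_step an bn a'n.
Qed.

Lemma transfer_addp n : T (n + p) = T n *m T p.
Proof.
elim: n => [|n IH]; first by rewrite add0n mul1mx.
by rewrite addSn (transferS (n + p)) (transferS n) IH transfer_step_addp -mulmxA.
Qed.

(** The determinants of the steps are [a_ n / a_ n.+1]: their product
    telescopes to [a_ 0 / a_ p]. *)
Lemma det_transfer : \det (T p) = 1.
Proof.
suff H n : \det (T n) * (cx (a_ n))%:P = (cx (a_ 0))%:P.
  have := H p; rewrite a_0 -[X in _ = X]mul1r => /mulIf -> //.
  by rewrite polyC_eq0 cx_a_neq0.
elim: n => [|n IH]; first by rewrite det1 mul1r.
rewrite /= det_mulmx mulrAC -{}IH [RHS]mulrC; congr (_ * _).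
rewrite detZ det_mx22 !mxE /= mulr0 sub0r.
have e : ((cx (a_ n.+1))^-1)%:P * (cx (a_ n.+1))%:P = 1 :> {poly Cx R}.
  by rewrite -polyCM mulVf // cx_a_neq0.
rewrite mulNr opprK expr2.
by rewrite -[RHS]mulr1 -[in RHS](mulr1 1) -e; ring.
Qed.

Lemma transfer_rec n : T (n + p + p) = Delta *: T (n + p) - T n.
Proof.
rewrite !transfer_addp -mulmxA mx22_square det_transfer -/(discriminant p a_ b_).
by rewrite mulmxBr -scalemxAr mulmx1.
Qed.

Lemma orthop_rec n : U (n + p + p) = Delta * U (n + p) - U n.
Proof. by rewrite -!transfer10 transfer_rec !mxE. Qed.

(** At [z] this is the sum of the [m]-th powers of the two eigenvalues: a
    polynomial that stands for the dominant one and, like it, has no zeros off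
    the bands. *)
Definition trace_power m : {poly Cx R} := \tr (T (m * p)).

Lemma trace_power_rec m :
  trace_power m.+2 = Delta * trace_power m.+1 - trace_power m.
Proof.
rewrite /trace_power (_ : m.+2 * p = m * p + p + p)%N; last by lia.
rewrite (_ : m.+1 * p = m * p + p)%N; last by lia.
by rewrite transfer_rec raddfB /= mxtraceZ.
Qed.

Lemma orthop_addp b :
  U (b + p) = secondp a_ b_ b * U p + U b * U p.+1.
Proof.
rewrite -transfer10 transfer_addp mxE !big_ord_recl big_ord0 ord2_1 addr0.
by rewrite !transfer10 transfer00 addrC.
Qed.

(** The product of the two conjugates [U (b + p) - Gamma * U b], one for each
    eigenvalue [Gamma]; off the bands, [jfun] vanishes only where this
    polynomial does. *)
Definition zero_locus b : {poly Cx R} :=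
  U (b + p) ^+ 2 - Delta * U (b + p) * U b + U b ^+ 2.

Lemma zero_locus_neq0 b : zero_locus b != 0.
Proof.
apply: quadratic_form_neq0; first by rewrite size_discriminant.
by rewrite -size_poly_eq0 size_orthop addn_eq0 negb_and -!lt0n p_gt0 orbT.
Qed.

(** [U (b + p)] and [Delta * U b] have the same degree, but their difference is
    [secondp b * U p - secondp p * U b], where the leading terms are gone. *)
Lemma size_zero_locus b : (0 < b)%N -> (size (zero_locus b) <= 2 * p + 2 * b - 3)%N.
Proof.
move=> b0; set V := secondp a_ b_ b * U p - secondp a_ b_ p * U b.
have -> : zero_locus b = U (b + p) * V + U b ^+ 2.
  rewrite /zero_locus {3}orthop_addp /V discriminantE.
  by rewrite [in LHS]orthop_addp; ring.
have sV : (size V <= (p + b).-2)%N.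
  have bound (q : {poly Cx R}) m n :
      (size q <= m.-1)%N -> (0 < m)%N -> (0 < n)%N -> (size (q * U n)%R <= (m + n).-2)%N.
    move=> qm m0 n0; rewrite (leq_trans (size_polyMleq _ _)) // size_orthop.
    by move: (size q) qm m0 n0 => k; lia.
  rewrite (leq_trans (size_polyD _ _)) // size_polyN geq_max; apply/andP; split.
    by rewrite addnC bound // size_secondp.
  by rewrite bound // size_secondp.
rewrite (leq_trans (size_polyD _ _)) // geq_max; apply/andP; split.
  rewrite (leq_trans (size_polyMleq _ _)) // size_orthop.
  by move: (size V) b0 p_gt0 sV => k; lia.
rewrite expr2 (leq_trans (size_polyMleq _ _)) // size_orthop.
by move: b0 p_gt0; lia.
Qed.

End Transfer.

(** * Neighbourhoods in the complex plane *)

Section ComplexNeighbourhoods.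
Variable R : realType.
Implicit Types z w : Cx R.

Lemma near_cmodP z (P : Cx R -> Prop) :
  (\forall w \near z, P w) <->
  exists2 e : R, 0 < e & forall w, cmod (w - z) < e -> P w.
Proof.
rewrite nbhs_normP; split=> [[e /= e0 H]|[e e0 H]].
  have eE : e = cx (complex.Re e) by rewrite /cx RRe_real // gtr0_real.
  exists (complex.Re e); first by move: e0; rewrite eE -cx_lt.
  by move=> w we; apply: H; rewrite /= eE distrC cmod_lt.
exists (cx e); first by rewrite /= cx_lt.
by move=> w /=; rewrite distrC cmod_lt; exact: H.
Qed.

Lemma cmod_cvgP (T : Type) (F : set_system T) (FF : Filter F)
    (f : T -> Cx R) (l : Cx R) :
  f @ F --> l <-> forall e : R, 0 < e -> \forall t \near F, cmod (f t - l) < e.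
Proof.
rewrite cvgrPdist_lt; split=> H e e0.
  have e0' : 0 < cx e by rewrite cx_lt.
  by have := H (cx e) e0'; apply: filterS => t; rewrite distrC cmod_lt.
have eE : e = cx (complex.Re e) by rewrite /cx RRe_real // gtr0_real.
have e0' : 0 < complex.Re e by move: e0; rewrite eE -cx_lt.
by have := H _ e0'; apply: filterS => t; rewrite distrC eE cmod_lt.
Qed.

Lemma cmod_continuousP (f : Cx R -> Cx R) z : {for z, continuous f} <->
  forall e : R, 0 < e -> \forall w \near z, cmod (f w - f z) < e.
Proof.
split=> [c e e0|H]; first by move/cmod_cvgP/(_ e e0): c.
exact: (proj2 (@cmod_cvgP _ (nbhs z) _ f (f z)) H).
Qed.

Lemma horner_continuous (P : {poly Cx R}) : continuous (horner P : Cx R -> Cx R).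
Proof.
move=> z; elim/poly_ind: P => [|P c IH].
  have -> : horner 0 = cst 0 :> (Cx R -> Cx R).
    by apply/funext => x; rewrite horner0.
  exact: cst_continuous.
have -> : horner (P * 'X + c%:P) = (fun x => P.[x] * x + c).
  by apply/funext => x; rewrite hornerMXaddC.
apply: (@continuousD _ _ _ (fun x => P.[x] * x) (cst c)).
  apply: (@continuousM _ _ (fun x => P.[x]) (fun x => x)); first exact: IH.
  exact: cvg_id.
exact: cst_continuous.
Qed.

Lemma near_cmod_bounded (f : Cx R -> Cx R) z : {for z, continuous f} ->
  \forall w \near z, cmod (f w) < cmod (f z) + 1.
Proof.
move=> /cmod_cvgP/(_ 1 ltr01); apply: filterS => w; have := cmodB_ge (f w) (f z).
lra.
Qed.

(** A point off the segment is separated from it by its imaginary part or by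
    its real part, and both are 1-Lipschitz. *)
Lemma near_not_segment (a b z : Cx R) : (a \is Num.real) -> b \is Num.real ->
  ~ (a <= z <= b) -> \forall w \near z, ~ (a <= w <= b).
Proof.
move=> /complex_realP[x ->] /complex_realP[y ->] nz; apply/near_cmodP.
have reD w : `|complex.Re w - complex.Re z| <= cmod (w - z).
  by rewrite -cx_le -cmodE -(raddfB (@complex.Re R)); exact: normc_ge_Re.
have imD w : `|complex.Im w - complex.Im z| <= cmod (w - z).
  rewrite -cx_le -cmodE normc_def /cx lecR -sqrtr_sqr ler_wsqrtr //.
  by rewrite -(raddfB (@complex.Im R)) lerDr sqr_ge0.
have [zi|zi] := eqVneq (complex.Im z) 0; last first.
  exists `|complex.Im z|; first by rewrite normr_gt0.
  move=> w wz; rewrite !lecE /= => /andP[/andP[/eqP iw _] _].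
  by have := imD w; rewrite iw sub0r normrN leNgt wz.
have [lx|lx] := ltP (complex.Re z) x.
  exists (x - complex.Re z); first by rewrite subr_gt0.
  move=> w wz; rewrite !lecE /= => /andP[/andP[_ xw] _].
  move: wz; rewrite ltNge => /negP; apply.
  by rewrite (le_trans _ (reD w)) // (le_trans _ (ler_norm _)) // lerD2r.
have [ly|ly] := ltP y (complex.Re z).
  exists (complex.Re z - y); first by rewrite subr_gt0.
  move=> w wz; rewrite !lecE /= => /andP[_ /andP[_ wy]].
  move: wz; rewrite ltNge => /negP; apply.
  rewrite (le_trans _ (reD w)) // distrC (le_trans _ (ler_norm _)) //.
  by rewrite lerD2l lerN2.
by exfalso; apply: nz; rewrite !lecE /= zi eqxx lx ly.
Qed.

Lemma bands_closed (p : nat) (alpha beta : 'I_p -> R) z :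
  ~ bands alpha beta z -> \forall w \near z, ~ bands alpha beta w.
Proof.
move=> nz; have : \forall w \near z, forall j, ~ (cx (alpha j) <= w <= cx (beta j)).
  apply: (@filter_forall _ _
    (fun j w => ~ (cx (alpha j) <= w <= cx (beta j))) (nbhs z) _) => j.
  apply: near_not_segment.
  - by apply/complex_realP; exists (alpha j).
  - by apply/complex_realP; exists (beta j).
  - by move=> zj; apply: nz; exists j.
by apply: filterS => w wn [j /wn].
Qed.

End ComplexNeighbourhoods.

(** * The eigenvalues of the period matrix *)

Section OffBands.
Variables (R : realType) (p : nat) (a_ b_ : nat -> R).

Local Notation Delta := (discriminant p a_ b_).
Local Notation g := (Gamma_plus p a_ b_).
Local Notation h := (Gamma_minus p a_ b_).

Lemma GammaD z : g z + h z = Delta.[z].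
Proof. by rewrite /Gamma_plus /Gamma_minus; case: ifP => _; field. Qed.

Lemma GammaM z : g z * h z = 1.
Proof.
rewrite /Gamma_plus /Gamma_minus /=; set d := _ / 2.
have : sqrtC (d ^+ 2 - 1) ^+ 2 = d ^+ 2 - 1 by rewrite sqrtCK.
move: (sqrtC _) => s s2; have ds : (d + s) * (d - s) = 1.
  have -> : (d + s) * (d - s) = d ^+ 2 - s ^+ 2 by ring.
  by rewrite s2; ring.
by case: ifP => _; rewrite // mulrC.
Qed.

Lemma le_Gamma z : cmod (h z) <= cmod (g z).
Proof.
rewrite -cx_le -!cmodE /Gamma_plus /Gamma_minus; case: ifPn => [/ltW //|].
by rewrite -real_leNgt ?normr_real.
Qed.

Lemma cmod_GammaM z : cmod (g z) * cmod (h z) = 1.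
Proof. by rewrite -cmodM GammaM cmod1. Qed.

Lemma Gamma_plus_neq0 z : g z != 0.
Proof.
apply/eqP => g0; have := GammaM z; rewrite g0 mul0r => /eqP.
by rewrite eq_sym oner_eq0.
Qed.

Lemma cmod_Gamma_plus_ge1 z : 1 <= cmod (g z).
Proof.
rewrite leNgt; apply/negP => g1; have := le_Gamma z; have := cmod_GammaM z.
have := cmod_ge0 (g z); have := cmod_ge0 (h z); nra.
Qed.

(** If both eigenvalues had modulus 1, they would be conjugate to each other,
    being inverse, and [Delta] would be twice the real part of either. *)
Lemma cmod_Gamma_minus_lt1 z : ~ (-2 <= Delta.[z] <= 2) -> cmod (h z) < 1.
Proof.
move=> nD; rewrite ltNge; apply/negP => h1; apply: nD.
have {}h1 : cmod (h z) = 1.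
  have := le_Gamma z; have := cmod_GammaM z; have := cmod_ge0 (g z); nra.
have g1 : cmod (g z) = 1 by have := cmod_GammaM z; rewrite h1 mulr1.
have gE : g z = (h z)^*.
  have /(canRL (mulKf (Gamma_plus_neq0 z))) := GammaM z.
  rewrite mulr1 => ->; rewrite invC_norm cmodE g1 expr1n invr1 mul1r conjCK //.
rewrite -GammaD -real_ler_norml.
  have -> : 2 = cx 2 :> Cx R by rewrite cx_nat.
  by rewrite cmod_le; have := cmodD (g z) (h z); rewrite g1 h1; lra.
by rewrite CrealE rmorphD /= gE conjCK addrC.
Qed.


(** Inside (-2, 2) the hypothesis on the edges applies.  If [Delta]
    takes the value 2 or -2 at [z], then a value at small distance [t] from it
    and inside has a preimage at distance less than [e] from [z], for any [e]:
    [z] would be a limit of points of the bands. *)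
Lemma off_bands_discriminant (alpha beta : 'I_p -> R) z :
  (0 < p)%N -> (forall n, (0 < n)%N -> 0 < a_ n) ->
  band_edges a_ b_ alpha beta -> ~ bands alpha beta z ->
  ~ (-2 <= Delta.[z] <= 2).
Proof.
move=> p0 a_gt0 [_ _ edges] nz.
have inband w : -2 < Delta.[w] < 2 -> bands alpha beta w.
  by move=> /edges[j /andP[/ltW l /ltW r]]; exists j; rewrite l r.
have /near_cmodP[e e0 He] := bands_closed nz.
have D0 : Delta != 0 by rewrite -size_poly_eq0 size_discriminant.
(* [t < 4] keeps [2 - t] above [-2]; the other bound is what [root_near] asks. *)
have [t /andP[t0 tlt] t1] : exists2 t : R, 0 < t < cmod (lead_coef Delta) * e ^+ p & t < 4.
  set B := _ * _; have B0 : 0 < B by rewrite mulr_gt0 ?exprn_gt0 // cmod_gt0 lead_coef_eq0.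
  exists (Num.min B 2 / 2).
    have mB : Num.min B 2 <= B by rewrite ge_min lexx.
    by rewrite divr_gt0 ?lt_min ?B0 //=; move: B0 mB; lra.
  have m2 : Num.min B 2 <= 2 by rewrite ge_min lexx orbT.
  by move: m2; lra.
have near_edge (s : Cx R) : cmod s = t -> ~ (-2 < Delta.[z] - s < 2).
  move=> st ins; pose Q := Delta - (Delta.[z] - s)%:P.
  have sQ : size Q = p.+1.
    rewrite size_polyDl ?size_discriminant // size_polyN.
    by rewrite ltnS (leq_trans (size_polyC_leq1 _)).
  have lQ : lead_coef Q = lead_coef Delta.
    rewrite lead_coefDl // size_discriminant // size_polyN.
    by rewrite ltnS (leq_trans (size_polyC_leq1 _)).
  have [|||r rQ rz] := @root_near R Q z e.
  - by rewrite -size_poly_eq0 sQ.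
  - exact: ltW.
  - by rewrite sQ lQ /Q !hornerE opprB addrCA subrr addr0 st.
  apply: (He r rz); apply: inband; move: rQ.
  by rewrite /root /Q !hornerE subr_eq0 => /eqP ->.
move=> /andP[l r].
have tE : cmod (cx t) = t by rewrite cmod_cx ?ltW.
have c2 : 2 = cx 2 :> Cx R by rewrite cx_nat.
have [D2|nD2] := eqVneq Delta.[z] 2.
  apply: (near_edge _ tE); rewrite D2 c2 -cxB -cxN !cx_lt; lra.
have [Dm2|nDm2] := eqVneq Delta.[z] (-2).
  apply: (@near_edge (- cx t)); rewrite ?cmodN //.
  by rewrite Dm2 c2 opprK -cxN -cxD !cx_lt; lra.
by apply: nz; apply: inband; rewrite !lt_neqAle l r nD2 eq_sym nDm2.
Qed.

End OffBands.

(** * Asymptotics along the period *)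

Section Asymptotics.
Variables (R : realType) (p : nat) (a_ b_ : nat -> R).
Hypothesis p_gt0 : (0 < p)%N.
Hypothesis a_gt0 : forall n, (0 < n)%N -> 0 < a_ n.
Hypothesis a_per : forall n, (0 < n)%N -> a_ (n + p)%N = a_ n.
Hypothesis b_per : forall n, (0 < n)%N -> b_ (n + p)%N = b_ n.
Hypothesis a_0 : a_ 0%N = a_ p.

Local Notation Delta := (discriminant p a_ b_).
Local Notation g := (Gamma_plus p a_ b_).
Local Notation h := (Gamma_minus p a_ b_).
Local Notation U := (orthop a_ b_).
Local Notation D := (trace_power p a_ b_).

(** The square root in its definition is not continuous, but near [z] the
    number [h z] is almost a root of the quadratic equation of the eigenvalues
    at [w]; it must be close to [h w], since [g w] stays outside the unit disc,
    away from [h z]. *)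
Lemma Gamma_minus_continuous z : cmod (h z) < 1 -> {for z, continuous h}.
Proof.
move=> h1; apply/cmod_continuousP => e e0.
have d0 : 0 < 1 - cmod (h z) by rewrite subr_gt0.
have /cmod_continuousP/(_ _ (mulr_gt0 e0 d0)) := @horner_continuous _ Delta z.
apply: filterS => w Dw; rewrite -(ltr_pM2r d0); apply: le_lt_trans Dw.
have E : (h w - h z) * (g w - h z) = h z * (Delta.[z] - Delta.[w]).
  rewrite -!GammaD -[h z * _]addr0 -(subrr 1).
  by rewrite -{1}(GammaM p a_ b_ w) -(GammaM p a_ b_ z); ring.
have gh : 1 - cmod (h z) <= cmod (g w - h z).
  by apply: le_trans (cmodB_ge _ _); rewrite lerD2r cmod_Gamma_plus_ge1.
apply: le_trans (ler_wpM2l (cmod_ge0 (h w - h z)) gh) _.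
rewrite -cmodM E cmodM (cmodBC Delta.[w]) ler_piMl ?cmod_ge0 ?ltW //.
Qed.

Lemma Gamma_gap z : 1 - cmod (h z) <= cmod (g z - h z).
Proof. by apply: le_trans (cmodB_ge _ _); rewrite lerD2r cmod_Gamma_plus_ge1. Qed.

Lemma Gamma_neq z : cmod (h z) < 1 -> g z - h z != 0.
Proof. by move=> h1; rewrite -cmod_gt0 (lt_le_trans _ (Gamma_gap z)) // subr_gt0. Qed.

Lemma Gamma_plus_continuous z : cmod (h z) < 1 -> {for z, continuous g}.
Proof.
move=> h1; have -> : g = (fun w => Delta.[w] - h w).
  by apply/funext => w; rewrite -(GammaD p a_ b_ w) addrK.
apply: (@continuousB _ _ _ (fun w => Delta.[w]) h); first exact: horner_continuous.
exact: Gamma_minus_continuous.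
Qed.

Variable b : nat.

Lemma jfunE z : jfun p a_ b_ b z =
  (g z - h z)^-1 * ((U (b + p)).[z] - h z * (U b).[z]).
Proof.
rewrite /jfun /P_plus !mxE /= !transfer10 // !transfer00 // /horner_eval.
by rewrite mulr0n mulr1n orthop_addp // !hornerE; ring.
Qed.

Lemma jfun_continuous z : cmod (h z) < 1 -> {for z, continuous (jfun p a_ b_ b)}.
Proof.
move=> h1; have ch := Gamma_minus_continuous h1.
have cg := Gamma_plus_continuous h1.
rewrite (_ : jfun p a_ b_ b = fun w =>
  (g w - h w)^-1 * ((U (b + p)).[w] - h w * (U b).[w])); last first.
  by apply/funext => w; rewrite jfunE.
apply: (@continuousM _ _ (fun w => (g w - h w)^-1)
                         (fun w => (U (b + p)).[w] - h w * (U b).[w])).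
  apply: continuousV; first exact: Gamma_neq.
  exact: (@continuousB _ _ _ g h z cg ch).
apply: (@continuousB _ _ _ (fun w => (U (b + p)).[w]) (fun w => h w * (U b).[w])).
  exact: horner_continuous.
exact: (@continuousM _ _ h (fun w => (U b).[w]) z ch (@horner_continuous _ (U b) z)).
Qed.

Lemma orthop_closed z m :
  (g z - h z) * (U (m * p + b)).[z] =
    g z ^+ m * ((U (b + p)).[z] - h z * (U b).[z]) -
    h z ^+ m * ((U (b + p)).[z] - g z * (U b).[z]).
Proof.
have -> : (b + p = 1 * p + b)%N by rewrite mul1n addnC.
apply: (@linear_recurrence_closed _ (g z) (h z) (fun m => (U (m * p + b)).[z])).
move=> k; rewrite GammaM mul1r GammaD.
rewrite (_ : k.+2 * p + b = k * p + b + p + p)%N; last by rewrite !mulSn; lia.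
rewrite (_ : k.+1 * p + b = k * p + b + p)%N; last by rewrite !mulSn; lia.
by rewrite orthop_rec // !hornerE.
Qed.

Lemma trace_power_closed z m : g z - h z != 0 ->
  (D m).[z] = g z ^+ m + h z ^+ m.
Proof.
move=> gh; apply: (mulfI gh); have D0 : D 0 = 2 by rewrite /trace_power mxtrace1.
have D1 : D 1 = Delta by rewrite /trace_power mul1n.
rewrite (@linear_recurrence_closed _ (g z) (h z) (fun m => (D m).[z])); last first.
  by move=> k; rewrite GammaM mul1r GammaD trace_power_rec // !hornerE.
have -> : (D 0).[z] = 2 by rewrite D0 -[2]polyCMn hornerC.
by rewrite D1 -GammaD; ring.
Qed.

Lemma expr_eventually_small (t e : R) : 0 <= t < 1 -> 0 < e ->
  exists M : nat, forall m, (M <= m)%N -> t ^+ m < e.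
Proof.
move=> /andP[t0 t1] e0; have /cvg_expr : `|t| < 1 by rewrite ger0_norm.
move=> /cvgrPdist_lt/(_ e e0)[M _ HM]; exists M => m /HM /=.
by rewrite sub0r normrN ger0_norm // exprn_ge0.
Qed.

Lemma orthop_cvg z : cmod (h z) < 1 ->
  (fun m : nat => g z ^- m * (U (m * p + b)).[z]) @ \oo --> jfun p a_ b_ b z.
Proof.
move=> h1; have gh := Gamma_neq h1; apply/cmod_cvgP => e e0.
set B := ((U (b + p)).[z] - g z * (U b).[z]) / (g z - h z).
have E m : g z ^- m * (U (m * p + b)).[z] - jfun p a_ b_ b z = - (h z ^+ 2) ^+ m * B.
  apply: (mulfI gh); rewrite mulrBr mulrCA orthop_closed jfunE /B.
  have gm : g z ^+ m != 0 by rewrite expf_neq0 // Gamma_plus_neq0.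
  have -> : (h z ^+ 2) ^+ m = h z ^+ m / g z ^+ m.
    apply: (mulIf gm); rewrite divfK // -exprMn -[RHS]mul1r -(expr1n _ m).
    by rewrite -(GammaM p a_ b_ z) -exprMn; congr (_ ^+ _); ring.
  by field; rewrite gh gm.
have t1 : 0 <= cmod (h z) ^+ 2 < 1.
  by rewrite exprn_ge0 ?cmod_ge0 //= expr_lt1 ?cmod_ge0.
have eB : 0 < e / (cmod B + 1) by rewrite divr_gt0 // ltr_wpDl ?cmod_ge0.
have [M HM] := expr_eventually_small t1 eB.
exists M => // m /= /HM; rewrite ltr_pdivlMr; last by rewrite ltr_wpDl ?cmod_ge0.
apply: le_lt_trans; rewrite E cmodM cmodN !cmodX ler_wpM2l ?lerDl //.
by rewrite exprn_ge0 // exprn_ge0 // cmod_ge0.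
Qed.

(** The dominant powers cancel in [u_m - j * D_m], leaving the [m]-th power of
    [h] times [2 *: U (b + p) - Delta * U b], divided by [g - h]; near [z0] the
    modulus of [h] stays below some [t < 1]. *)
Lemma orthop_trace_power_unif z0 : cmod (h z0) < 1 ->
  exists2 r : R, 0 < r & forall eta, 0 < eta -> exists M, forall m z,
    (M <= m)%N -> cmod (z - z0) < r ->
    (D m).[z] != 0 /\
    cmod ((U (m * p + b)).[z] - jfun p a_ b_ b z * (D m).[z]) <= eta * cmod (D m).[z].
Proof.
move=> h1; pose W := 2 *: U (b + p) - Delta * U b.
have := near_cmod_bounded (@horner_continuous _ W z0).
set K := _ + 1 => nW; pose t := (1 + cmod (h z0)) / 2.
have h0 := cmod_ge0 (h z0).
have th : 0 < t - cmod (h z0) by rewrite /t; lra.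
have t01 : 0 <= t < 1 by apply/andP; split; rewrite /t; lra.
have t1 : 0 < 1 - t by rewrite /t; lra.
have nh : \forall z \near z0, cmod (h z) < t.
  have /cmod_continuousP/(_ _ th) := Gamma_minus_continuous h1.
  by apply: filterS => z; have := cmodB_ge (h z) (h z0); lra.
have /near_cmodP[r r0 Hr] : \forall z \near z0, cmod W.[z] < K /\ cmod (h z) < t.
  by apply: filterS2 nW nh.
have K0 : 0 < K by rewrite ltr_wpDl ?cmod_ge0.
exists r => // eta eta0.
have [M HM] := expr_eventually_small t01 (divr_gt0 (mulr_gt0 eta0 (mulr_gt0 t1 t1)) K0).
exists M.+1 => m z Mm /Hr[Wz hz].
have {HM} := HM m (ltnW Mm); rewrite ltr_pdivlMr // => tm.
have hz1 : cmod (h z) < 1 by rewrite (lt_trans hz) //; case/andP: t01.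
have gh := Gamma_neq hz1; have gap := Gamma_gap z.
have hm : cmod (h z) ^+ m <= t ^+ m.
  by rewrite lerXn2r ?nnegrE ?cmod_ge0 ?(ltW hz) //; case/andP: t01.
have Dm : 1 - t <= cmod (D m).[z].
  rewrite trace_power_closed // (le_trans _ (cmodD_ge _ _)) // !cmodX.
  apply: lerB; first by rewrite exprn_ege1 // cmod_Gamma_plus_ge1.
  apply: (le_trans hm); case: m Mm {tm hm} => // m _.
  by rewrite exprS ler_piMr ?exprn_ile1 //; case/andP: t01 => // _ /ltW.
have D0 : 0 < cmod (D m).[z] by rewrite (lt_le_trans t1).
split; first by rewrite -cmod_gt0.
have gap' : 1 - t <= cmod (g z - h z) by rewrite (le_trans _ gap) // lerB // ltW.
have G0 : 0 < cmod (g z - h z) by rewrite (lt_le_trans t1).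
have E : (g z - h z) * ((U (m * p + b)).[z] - jfun p a_ b_ b z * (D m).[z]) =
    - (h z ^+ m * W.[z]).
  have -> : W.[z] = 2 * (U (b + p)).[z] - Delta.[z] * (U b).[z] by rewrite /W !hornerE.
  by rewrite mulrBr orthop_closed jfunE trace_power_closed // -GammaD; field.
rewrite -(ler_pM2l G0) -cmodM E cmodN cmodM cmodX.
apply: (@le_trans _ _ (t ^+ m * K)).
  by rewrite ler_pM ?exprn_ge0 ?cmod_ge0 // ltW.
apply: (le_trans (ltW tm)); rewrite [leRHS]mulrCA ler_pM2l //.
by rewrite ler_pM // ltW.
Qed.

Lemma jfun_zero_locus z : g z - h z != 0 ->
  (zero_locus p a_ b_ b).[z] =
    jfun p a_ b_ b z * ((g z - h z) * ((U (b + p)).[z] - g z * (U b).[z])).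
Proof.
move=> gh; have -> : (zero_locus p a_ b_ b).[z] = (U (b + p)).[z] ^+ 2 -
    Delta.[z] * (U (b + p)).[z] * (U b).[z] + (U b).[z] ^+ 2.
  by rewrite /zero_locus !hornerE.
rewrite jfunE -GammaD.
transitivity (((U (b + p)).[z] - h z * (U b).[z]) * ((U (b + p)).[z] - g z * (U b).[z])).
  by rewrite -[X in _ + X]mul1r -(GammaM p a_ b_ z); ring.
by field.
Qed.

End Asymptotics.

(** * Zeros of the limit function *)

Section ZeroSets.
Variable R : realType.

(** Any radius below the distances from [z0] to the other roots will do, also
    if [z0] is itself a root. *)
Lemma horner_circle_lower_bound (P : {poly Cx R}) z0 (r : R) : P != 0 -> 0 < r ->
  exists s c : R, [/\ 0 < s, s < r, 0 < c &
    forall z, cmod (z - z0) = s -> c <= cmod P.[z]].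
Proof.
move=> P0 r0.
have [d d0 Hd] : exists2 d : R, 0 < d &
    {in croots P, forall x, 0 < cmod (x - z0) -> d <= cmod (x - z0)}.
  elim: (croots P) => [|x xs [d d0 Hd]]; first by exists 1.
  have [x0|x0] := ltP 0 (cmod (x - z0)).
    exists (Num.min d (cmod (x - z0))); first by rewrite lt_min d0.
    move=> y; rewrite inE => /predU1P[-> _|/Hd H /H]; first by rewrite ge_min lexx orbT.
    by rewrite ge_min => ->.
  exists d => // y; rewrite inE => /predU1P[->|/Hd //].
  by rewrite ltNge x0.
pose s := Num.min d r / 2.
have m0 : 0 < Num.min d r by rewrite lt_min d0.
have s0 : 0 < s by rewrite divr_gt0.
have sm : s < Num.min d r by rewrite /s; move: m0; lra.
have [sd sr] : s < d /\ s < r by move: sm; rewrite lt_min => /andP.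
exists s, (cmod (lead_coef P) * \prod_(x <- croots P) `|cmod (x - z0) - s|).
split=> //.
  rewrite mulr_gt0 ?cmod_gt0 ?lead_coef_eq0 // big_seq prodr_gt0 // => x xP.
  rewrite normr_gt0 subr_eq0; have [x0|x0] := ltP 0 (cmod (x - z0)).
    by rewrite gt_eqF // (lt_le_trans sd) ?Hd.
  by rewrite lt_eqF // (le_lt_trans x0).
move=> z zs; rewrite cmod_horner ler_wpM2l ?cmod_ge0 // ler_prod // => x _.
rewrite normr_ge0 ler_norml lerNl opprB /=.
have E : x - z0 - (z - z0) = x - z by ring.
have := cmodB_ge (x - z0) (z - z0); have := cmodB_ge (z - z0) (x - z0).
by rewrite (cmodBC (z - z0)) E zs => -> ->.
Qed.

Lemma card_le_roots (P : {poly Cx R}) (A : set (Cx R)) n :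
  P != 0 -> (size P <= n.+1)%N -> (forall z, A z -> root P z) -> (A #<= `I_n)%card.
Proof.
move=> P0 sP AP; apply: (@card_le_trans _ _ _ [set nth 0 (croots P) i | i in `I_n]).
  apply: subset_card_le => z /AP; rewrite -mem_croots // => zP.
  exists (index z (croots P)); last exact: nth_index.
  by rewrite /= (leq_trans _ (_ : size (croots P) <= n)%N) ?index_mem // -ltnS -size_croots.
exact: card_image_le.
Qed.

Variables (p : nat) (a_ b_ : nat -> R).
Hypothesis p_gt0 : (0 < p)%N.
Hypothesis a_gt0 : forall n, (0 < n)%N -> 0 < a_ n.
Hypothesis a_per : forall n, (0 < n)%N -> a_ (n + p)%N = a_ n.
Hypothesis b_per : forall n, (0 < n)%N -> b_ (n + p)%N = b_ n.
Hypothesis a_0 : a_ 0%N = a_ p.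
Variable b : nat.

Local Notation g := (Gamma_plus p a_ b_).
Local Notation h := (Gamma_minus p a_ b_).
Local Notation U := (orthop a_ b_).
Local Notation D := (trace_power p a_ b_).
Local Notation j := (jfun p a_ b_ b).

Variable z0 : Cx R.
Hypothesis h1 : cmod (h z0) < 1.

Let unif := orthop_trace_power_unif p_gt0 a_gt0 a_per b_per a_0 b h1.

(** Near [z0] the modulus of [j] is at least half its value at [z0], while the
    error of [j * D_m] as an approximation of [u_m] is a quarter of it. *)
Lemma orthop_near_nonvanishing : j z0 != 0 -> exists (e : R) (M : nat), 0 < e /\
  forall (z : Cx R) (m : nat), `|z - z0| < cx e -> (M <= m)%N ->
    (U (m * p + b)).[z] != 0.
Proof.
rewrite -cmod_gt0 => j0; have [r r0 H] := unif.
have eta0 : 0 < cmod (j z0) / 4 by rewrite divr_gt0.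
have [M HM] := H _ eta0.
have /cmod_continuousP/(_ _ eta0)/near_cmodP[d d0 Hd] :=
  jfun_continuous a_gt0 a_per b_per a_0 (b := b) h1.
exists (Num.min r d), M; split; first by rewrite lt_min r0.
move=> z m; rewrite cmod_lt lt_min => /andP[zr zd] Mm.
have [Dz Uz] := HM m z Mm zr; have jz := Hd z zd.
rewrite -cmod_gt0; rewrite -cmod_gt0 in Dz.
have {}jz : cmod (j z0) / 2 <= cmod (j z).
  by have := cmodB_ge (j z0) (j z); rewrite cmodBC; lra.
have := cmodB_ge (j z * (D m).[z]) (U (m * p + b)).[z].
rewrite cmodBC cmodM; have := ler_wpM2r (ltW Dz) jz; have := mulr_gt0 j0 Dz; move: Uz.
by move: (cmod (U _).[z]) (cmod (D m).[z]) (cmod (j z0)) (cmod (j z) * _) (cmod (_ - _))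
  => w v u y x; lra.
Qed.

(** [jfun] divides the nonzero polynomial [zero_locus], with a cofactor which is
    continuous, hence bounded near [z0]. *)
Lemma jfun_circle_lower_bound (r : R) : 0 < r -> exists s c : R,
  [/\ 0 < s, s < r, 0 < c & forall z, cmod (z - z0) = s -> c <= cmod (j z)].
Proof.
move=> r0.
pose F w := (g w - h w) * ((U (b + p)).[w] - g w * (U b).[w]).
have cg := Gamma_plus_continuous h1; have ch := Gamma_minus_continuous h1.
have cF : {for z0, continuous F}.
  apply: (@continuousM _ _ (fun w => g w - h w)
                           (fun w => (U (b + p)).[w] - g w * (U b).[w])).
    exact: (@continuousB _ _ _ g h z0 cg ch).
  apply: (@continuousB _ _ _ (fun w => (U (b + p)).[w]) (fun w => g w * (U b).[w])).
    exact: horner_continuous.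
  exact: (@continuousM _ _ g (fun w => (U b).[w]) z0 cg (@horner_continuous _ (U b) z0)).
have := near_cmod_bounded cF; set K := _ + 1 => nF.
have K0 : 0 < K by rewrite ltr_wpDl ?cmod_ge0.
have nh : \forall w \near z0, cmod (h w) < 1.
  have d0 : 0 < 1 - cmod (h z0) by rewrite subr_gt0.
  have /cmod_continuousP/(_ _ d0) := ch; apply: filterS => w.
  by have := cmodB_ge (h w) (h z0); lra.
have /near_cmodP[d d0 Hd] : \forall w \near z0, cmod (F w) < K /\ cmod (h w) < 1.
  by apply: filterS2 nF nh.
have N0 := zero_locus_neq0 b_ a_gt0 p_gt0 b.
have m0 : 0 < Num.min r d by rewrite lt_min r0.
have [s [c [s0 + c0 Hc]]] := horner_circle_lower_bound z0 N0 m0.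
rewrite lt_min => /andP[sr sd].
exists s, (c / K); split; rewrite ?divr_gt0 // => z zs.
have [|Fz hz] := Hd z; first by rewrite zs.
rewrite ler_pdivrMr // (le_trans (Hc z zs)) //.
rewrite jfun_zero_locus //; last exact: Gamma_neq.
by rewrite cmodM ler_wpM2l ?cmod_ge0 // ltW.
Qed.

(** On a small circle [j], thus [u_m / D_m], is bounded below, whereas at the
    centre [u_m / D_m] tends to zero. *)
Lemma orthop_zero_near : j z0 = 0 -> forall e : R, 0 < e ->
  exists M : nat, forall m : nat, (M <= m)%N ->
    exists z : Cx R, `|z - z0| < cx e /\ (U (m * p + b)).[z] = 0.
Proof.
move=> j0 e e0; have [r r0 H] := unif.
have m0 : 0 < Num.min r e by rewrite lt_min r0.
have [s [c [s0 + c0 Hc]]] := jfun_circle_lower_bound m0.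
rewrite lt_min => /andP[sr se].
have eta0 : 0 < c / 4 by rewrite divr_gt0.
have [M HM] := H _ eta0; exists M => m Mm.
(* With relative error [c / 4], [2 / c] bounds [D_m / u_m] on the circle, while
   [u_m / D_m] is at most [c / 4] at the centre. *)
have K0 : 0 < 2 / c by rewrite divr_gt0.
have [|z zs||z rz zs] := @zero_in_disc R (U (m * p + b)) (D m) z0 s (2 / c) s0 K0.
- by move=> z zs; case: (HM m z Mm (le_lt_trans zs sr)).
- have [|Dz Uz] := HM m z Mm; first by rewrite zs.
  rewrite -cmod_gt0 in Dz; rewrite mulrAC ler_pdivlMr // mulrC.
  have := cmodB_ge (j z * (D m).[z]) (U (m * p + b)).[z].
  rewrite cmodBC cmodM; have := ler_wpM2r (ltW Dz) (Hc z zs); move: Uz.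
  have := mulr_gt0 c0 Dz.
  by move: (cmod (U _).[z]) (cmod (D m).[z]) (cmod (j z) * _) (cmod (_ - _))
    => w v y x; lra.
- have [|Dz] := HM m z0 Mm; first by rewrite subrr cmod0.
  rewrite j0 mul0r subr0 -cmod_gt0 in Dz * => Uz.
  rewrite mulrAC ltr_pdivrMr // [ltRHS]mulrC; move: Uz (mulr_gt0 c0 Dz).
  by move: (cmod _) (cmod _) => x y; lra.
by exists z; rewrite cmod_lt (le_lt_trans zs se); split=> //; exact/rootP.
Qed.

(** With [j z = (z - z0) ^+ k * f z], the error of [(z - z0) ^+ k * f z0 * D_m]
    as an approximation of [u_m] has two parts: an eighth from the variation of
    [f], and a sixteenth from that of [u_m / D_m], as [(z - z0) ^+ k] is bounded
    below for [e / 2 <= cmod (z - z0)]. *)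
Lemma orthop_zero_count k : zero_of_order j z0 k ->
  exists e0 : R, 0 < e0 /\ forall e : R, 0 < e -> e < e0 ->
    exists M : nat, forall m : nat, (M <= m)%N ->
      zeros_in_disc (U (m * p + b)) z0 e k.
Proof.
move=> [f [df f0 jf]]; have [r r0 H] := unif.
have cf : {for z0, continuous f}.
  by apply: differentiable_continuous; apply/derivable1_diffP; exact: nbhs_singleton df.
have cf0 : 0 < cmod (f z0) by rewrite cmod_gt0.
have f8 : 0 < cmod (f z0) / 8 by rewrite divr_gt0.
have /cmod_continuousP/(_ _ f8) nf := cf.
have /near_cmodP[d d0 Hd] : \forall z \near z0,
    cmod (f z - f z0) < cmod (f z0) / 8 /\ j z = (z - z0) ^+ k * f z.
  by apply: filterS2 nf jf.
exists (Num.min r d); split=> [|e e0]; first by rewrite lt_min r0.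
rewrite lt_min => /andP[er ed].
have eta0 : 0 < (e / 2) ^+ k * cmod (f z0) / 16.
  by rewrite divr_gt0 // mulr_gt0 // exprn_gt0 // divr_gt0.
have [M HM] := H _ eta0; exists M => m Mm.
apply: (@zeros_in_disc_compare R (U (m * p + b)) (D m) z0 e (f z0) k e0 f0).
  by move=> z ze; case: (HM m z Mm (le_lt_trans ze er)).
move=> z /andP[ez ze].
have [Dz Uz] := HM m z Mm (le_lt_trans ze er).
have [fz jz] := Hd z (le_lt_trans ze ed).
have -> : (U (m * p + b)).[z] - (z - z0) ^+ k * f z0 * (D m).[z] =
    ((U (m * p + b)).[z] - j z * (D m).[z]) +
    (z - z0) ^+ k * (D m).[z] * (f z - f z0) by rewrite jz; ring.
set q := cmod ((z - z0) ^+ k * (D m).[z]).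
have tri := cmodD ((U (m * p + b)).[z] - j z * (D m).[z])
  ((z - z0) ^+ k * (D m).[z] * (f z - f z0)).
have A1 : cmod ((z - z0) ^+ k * (D m).[z] * (f z - f z0)) <= q * (cmod (f z0) / 8).
  by rewrite cmodM ler_wpM2l ?cmod_ge0 // ltW.
have A2 : cmod ((U (m * p + b)).[z] - j z * (D m).[z]) <= q * (cmod (f z0) / 16).
  rewrite /q cmodM cmodX; apply: (le_trans Uz).
  have -> : (e / 2) ^+ k * cmod (f z0) / 16 * cmod (D m).[z] =
    (e / 2) ^+ k * cmod (D m).[z] * (cmod (f z0) / 16) by ring.
  rewrite ler_wpM2r ?divr_ge0 ?cmod_ge0 // ler_wpM2r ?cmod_ge0 //.
  by rewrite lerXn2r ?nnegrE ?cmod_ge0 // ltW // divr_gt0.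
have -> : cmod ((z - z0) ^+ k * f z0 * (D m).[z]) = q * cmod (f z0).
  by rewrite mulrAC cmodM.
have q0 : 0 <= q * cmod (f z0) by rewrite mulr_ge0 ?cmod_ge0.
move: tri A1 A2 q0; move: (cmod (_ * (_ - _))) (cmod (_ - _)) (cmod (_ + _)) => t y x.
by move: (cmod (f z0)) q => v u; lra.
Qed.

End ZeroSets.

Theorem theorem2p4 (R : realType) (p : nat) (a_ b_ : nat -> R)
    (alpha beta : 'I_p -> R) (b : nat)
    (p_gt0 : (0 < p)%N)
    (a_gt0 : forall n, (0 < n)%N -> 0 < a_ n)
    (a_per : forall n, (0 < n)%N -> a_ (n + p)%N = a_ n)
    (b_per : forall n, (0 < n)%N -> b_ (n + p)%N = b_ n)
    (a_0 : a_ 0%N = a_ p)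
    (edges : band_edges a_ b_ alpha beta) :
  [/\
      forall z : Cx R, ~ bands alpha beta z ->
        (fun m : nat => (Gamma_plus p a_ b_ z) ^- m *
                        (orthop a_ b_ (m * p + b)%N).[z])
          @ \oo --> jfun p a_ b_ b z,
      forall z0 : Cx R, ~ bands alpha beta z0 -> jfun p a_ b_ b z0 != 0 ->
        exists (e : R) (M : nat), 0 < e /\
          forall (z : Cx R) (m : nat), `|z - z0| < cx e -> (M <= m)%N ->
            (orthop a_ b_ (m * p + b)%N).[z] != 0,
      forall z0 : Cx R, ~ bands alpha beta z0 -> jfun p a_ b_ b z0 = 0 ->
        forall e : R, 0 < e ->
          exists M : nat, forall m : nat, (M <= m)%N ->
            exists z : Cx R, `|z - z0| < cx e /\
              (orthop a_ b_ (m * p + b)%N).[z] = 0,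
      forall (z0 : Cx R) (k : nat), ~ bands alpha beta z0 ->
        jfun p a_ b_ b z0 = 0 -> zero_of_order (jfun p a_ b_ b) z0 k ->
        exists e0 : R, 0 < e0 /\
          forall e : R, 0 < e -> e < e0 ->
            exists M : nat, forall m : nat, (M <= m)%N ->
              zeros_in_disc (orthop a_ b_ (m * p + b)%N) z0 e k &
      (0 < b)%N ->
        ([set z : Cx R | ~ bands alpha beta z /\ jfun p a_ b_ b z = 0]
           #<= `I_(2 * p + 2 * b - 3)%N)%card].
Proof.
have h1 z : ~ bands alpha beta z -> cmod (Gamma_minus p a_ b_ z) < 1.
  by move=> nz; apply: cmod_Gamma_minus_lt1; exact: off_bands_discriminant edges nz.
split.
- by move=> z /h1; exact: orthop_cvg.
- by move=> z0 /h1; exact: orthop_near_nonvanishing.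
- by move=> z0 /h1; exact: orthop_zero_near.
- by move=> z0 k /h1 hz0 _; exact: orthop_zero_count.
move=> b0; apply: (@card_le_roots _ (zero_locus p a_ b_ b)).
- exact: zero_locus_neq0.
- by rewrite (leq_trans (size_zero_locus a_gt0 p_gt0 a_per b_per a_0 b0)).
move=> z [/h1 hz jz]; rewrite /root jfun_zero_locus //; last exact: Gamma_neq.
by rewrite jz mul0r.
Qed.
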